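(* Let $m>1$, $\sigma>0$, let $N\geq1$ be an integer and let $p\in(m,p_s(\sigma))$. If $$\sigma\geq\sigma^*:=\frac{mN+2}{m-1},$$ then the equation $u_t=\Delta u^m+|x|^{\sigma}u^p$ does not admit any radially symmetric self-similar solution of the form $u(x,t)=(T-t)^{-\alpha}f(\xi)$, $\xi=|x|(T-t)^{-\beta}$.
   Context: The Sobolev critical exponent is $p_s(\sigma)=\frac{m(N+2\sigma+2)}{N-2}$ if $N\geq3$ and $p_s(\sigma)=+\infty$ if $N\in\{1,2\}$. The equation is posed for $x\in\mathbb{R}^N$, $t\in(0,T)$, $T>0$, and $$\alpha=\frac{\sigma+2}{L},\quad \beta=\frac{p-m}{L},\quad L=\sigma(m-1)+2(p-1).$$ A self-similar solution of the form $u(x,t)=(T-t)^{-\alpha}f(\xi)$, $\xi=|x|(T-t)^{-\beta}$, is understood to be nonnegative and nontrivial, with a continuous profile $f:[0,\infty)\to[0,\infty)$ solving, wherever it is positive on $(0,\infty)$, $$(f^m)''(\xi)+\frac{N-1}{\xi}(f^m)'(\xi)-\alpha f(\xi)-\beta\xi f'(\xi)+\xi^{\sigma}f(\xi)^p=0,$$ with the contact condition $(f^m)'=0$ at interface points, and (by the convention fixed in the paper on the profiles under consideration) having one of the following behaviors near the origin: - $f(0)=A>0$, $f'(0)=0$; - $f(0)=0$ and $f(\xi)\sim\left[\frac{m-1}{2m(mN-N+2)}\right]^{1/(m-1)}\xi^{2/(m-1)}$ as $\xi\to0$; - (dead-core) there are $\xi_0\in(0,\infty)$, $\delta>0$ with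 $f=0$ on $[0,\xi_0]$, $f>0$ on $(\xi_0,\xi_0+\delta)$ and $(f^m)'(\xi_0)=0$; and the behavior $f(\xi)\sim C\xi^{-(\sigma+2)/(p-m)}$ as $\xi\to\infty$ for some $C>0$. *)

(* Defs.v *)
From HB Require Import structures.
From mathcomp Require Import all_boot all_order all_algebra.
From mathcomp Require Import all_classical all_reals all_analysis.
Set Implicit Arguments.
Unset Strict Implicit.
Unset Printing Implicit Defensive.
Import Order.TTheory GRing.Theory Num.Theory.
Import numFieldNormedType.Exports.
Local Open Scope ring_scope.
Local Open Scope classical_set_scope.

(* The library norm on 'rV[R]_N is the sup norm, so |x| is defined here. *)
Definition euclid_norm (R : realType) (N : nat) (x : 'rV[R]_N) : R :=
  Num.sqrt (\sum_(i < N) x 0 i ^+ 2).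

(* N.-2 would be truncated: the denominator is computed in R. *)
Definition sobolev_exp (R : realType) (N : nat) (m sigma : R) : \bar R :=
  if (3 <= N)%N then (m * (N%:R + 2 * sigma + 2) / (N%:R - 2))%:E else +oo%E.

Definition ss_L (R : realType) (m p sigma : R) : R :=
  sigma * (m - 1) + 2 * (p - 1).

Definition ss_alpha (R : realType) (m p sigma : R) : R :=
  (sigma + 2) / ss_L m p sigma.

Definition ss_beta (R : realType) (m p sigma : R) : R :=
  (p - m) / ss_L m p sigma.

Definition sigma_star (R : realType) (N : nat) (m : R) : R :=
  (m * N%:R + 2) / (m - 1).

(* Profiles are functions on [0, +oo): they are represented by functions on R
   whose values on the negative half-line are never constrained. *)

Definition fpow (R : realType) (m : R) (f : R -> R) : R -> R :=
  fun xi => f xi `^ m.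

(* At a point xi with 0 < xi and 0 < f xi. Since derive1 is total, the
   existence of f', (f^m)' and (f^m)'' is required explicitly. *)
Definition profile_ode_at (R : realType) (N : nat) (m p sigma : R)
    (f : R -> R) (xi : R) : Prop :=
  [/\ derivable f xi 1,
      (\forall x \near xi, derivable (fpow m f) x 1),
      derivable (derive1 (fpow m f)) xi 1 &
      derive1 (derive1 (fpow m f)) xi + (N%:R - 1) / xi * derive1 (fpow m f) xi
      - ss_alpha m p sigma * f xi - ss_beta m p sigma * xi * derive1 f xi
      + xi `^ sigma * f xi `^ p = 0].

Definition interface_point (R : realType) (f : R -> R) (xi : R) : Prop :=
  [/\ 0 < xi, f xi = 0 & closure [set x | 0 < x /\ 0 < f x] xi].

(* f(0) = A > 0 and f'(0) = 0, a one-sided derivative. *)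
Definition origin_positive (R : realType) (f : R -> R) : Prop :=
  0 < f 0 /\ (f h - f 0) / h @[h --> 0^'+] --> (0 : R).

(* f ~ g along F, for g nonvanishing along F. *)
Definition asymp_equiv (R : realType) (F : set_system R) (f g : R -> R) : Prop :=
  f x / g x @[x --> F] --> (1 : R).

Definition origin_zero (R : realType) (N : nat) (m : R) (f : R -> R) : Prop :=
  f 0 = 0 /\
  asymp_equiv 0^'+ f
    (fun xi => ((m - 1) / (2 * m * (m * N%:R - N%:R + 2))) `^ (1 / (m - 1))
               * xi `^ (2 / (m - 1))).

Definition origin_dead_core (R : realType) (m : R) (f : R -> R) : Prop :=
  exists xi0 delta : R,
    [/\ 0 < xi0, 0 < delta,
        (forall xi : R, 0 <= xi <= xi0 -> f xi = 0),
        (forall xi : R, xi0 < xi < xi0 + delta -> 0 < f xi) &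
        is_derive xi0 1 (fpow m f) 0].

Definition tail_decay (R : realType) (m p sigma : R) (f : R -> R) : Prop :=
  exists C : R, 0 < C /\
    asymp_equiv +oo f (fun xi => C * xi `^ (- ((sigma + 2) / (p - m)))).

Definition self_similar_profile (R : realType) (N : nat) (m p sigma : R)
    (f : R -> R) : Prop :=
  [/\ {within `[0, +oo[, continuous f} /\ (forall xi : R, 0 <= xi -> 0 <= f xi),
      (forall xi : R, 0 < xi -> 0 < f xi -> profile_ode_at N m p sigma f xi),
      (forall xi : R, interface_point f xi -> is_derive xi 1 (fpow m f) 0),
      [\/ origin_positive f, origin_zero N m f | origin_dead_core m f] &
      tail_decay m p sigma f].

(* Self-similar solution on R^N x (0, T) of u_t = Delta u^m + |x|^sigma u^p:
   being a solution is understood through the profile equation. *)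
Definition self_similar_solution (R : realType) (N : nat) (m p sigma T : R)
    (u : 'rV[R]_N -> R -> R) : Prop :=
  [/\ (forall (x : 'rV[R]_N) (t : R), 0 < t < T -> 0 <= u x t),
      (exists (x : 'rV[R]_N) (t : R), 0 < t < T /\ u x t != 0) &
      exists f : R -> R,
        self_similar_profile N m p sigma f /\
        forall (x : 'rV[R]_N) (t : R), 0 < t < T ->
          u x t = (T - t) `^ (- ss_alpha m p sigma)
                  * f (euclid_norm x * (T - t) `^ (- ss_beta m p sigma))].

(* Main.v *)
(** Put Y = x f'/f, X = (alpha/m) x^2 f^(1-m), Z = x^(sigma+2) f^(p-m) / m and
    kappa = beta/alpha = (p-m)/(sigma+2). The Pohozaev multiplier that kills the
    source term suggests the functions
      Z + (sigma+N) Y + (p+m)/2 Y^2 - X (a + b kappa Y),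
    the first part of which has, along the equation, a drift controlled by Y^2
    with a nonnegative coefficient exactly when p <= p_s. With a = 2m/(m+1) and
    (a,b) = (a,0), (a,a), (1,1) on the ranges Y >= 0, -1 <= kappa Y <= 0 and
    kappa Y <= -1 respectively, these glue into one continuous function that can
    only cross 0 upwards. It is nonnegative at the start of the last component of
    {f > 0}: there f = 0 and f rises, or f(0) > 0 and f'(0) = 0. Hence it is
    positive from then on.

    Once f decreases, positivity of the (1,1) function says precisely that
    - (f^m)' f^(-(p+m)/2) x^(-sigma-1) is nondecreasing. Integrating,
    f^(-(p-m)/2) >= c x^(sigma+2): the profile decays at least twice as fast as
    the tail x^(-(sigma+2)/(p-m)) allows. *)

Require Import Defs.
From HB Require Import structures.
From mathcomp Require Import all_boot all_order all_algebra.
From mathcomp Require Import all_classical all_reals all_analysis.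
From mathcomp Require Import ring lra.
Set Implicit Arguments.
Unset Strict Implicit.
Unset Printing Implicit Defensive.
Import Order.TTheory GRing.Theory Num.Theory.
Import numFieldNormedType.Exports.
Local Open Scope ring_scope.
Local Open Scope classical_set_scope.

(** * Real functions of one variable *)

Lemma is_derive_continuous (R : realType) (F : R -> R) (x D : R) :
  is_derive x 1 F D -> {for x, continuous F}.
Proof. by move=> HF; exact/differentiable_continuous/derivable1_diffP. Qed.

Lemma derive_gt0_near_left (R : realType) (F : R -> R) (x D : R) :
  is_derive x 1 F D -> 0 < D -> \forall y \near x^'-, F y < F x.
Proof.
move=> /is_derive1_caratheodory[g [Fg gx gxD]] D0.
have g0 : \forall y \near x, 0 < g y.
  by apply: (cvgr_gt (g x) gx); rewrite gxD.
near=> y.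
have yx : y < x by near: y; exact: nbhs_left_lt.
have gy : 0 < g y by near: y; exact: cvg_within.
by rewrite -subr_lt0 Fg pmulr_rlt0// subr_lt0.
Unshelve. all: by end_near. Qed.

(** At the infimum of the points where [H] is not positive, continuity makes [H] vanish, and the
    negative values just to its left contradict minimality. Only the behaviour at zeros is asked
    for, so the lemma applies to maxima and minima that need not be differentiable. *)
Lemma first_zero_gt0 (R : realType) (H : R -> R) (a b : R) :
  (forall x, a <= x <= b -> {for x, continuous H}) ->
  0 < H a ->
  (forall x, a < x <= b -> H x = 0 -> \forall y \near x^'-, H y < 0) ->
  forall x, a <= x <= b -> 0 < H x.
Proof.
move=> Hc Ha Hz x /andP[ax xb]; rewrite ltNge; apply/negP => Hx.
pose E := [set y | a <= y <= b /\ H y <= 0].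
have Ex : E x by split=> //; rewrite ax.
have infE : has_inf E.
  by split; [exists x | exists a => y [/andP[]]].
pose z := inf E.
have zx : z <= x by apply: ge_inf => //; exact: infE.2.
have az : a <= z by apply: lb_le_inf; [exists x | move=> y [/andP[]]].
have zab : a <= z <= b by rewrite az (le_trans zx).
have Hlt y : a <= y -> y < z -> 0 < H y.
  move=> ay yz; rewrite ltNge; apply/negP => Hy.
  have : z <= y.
    apply: ge_inf; first exact: infE.2.
    by split=> //; rewrite ay (le_trans (ltW yz))// (le_trans zx).
  by rewrite leNgt yz.
have Hz0 : H z <= 0.
  rewrite leNgt; apply/negP => Hzp.
  have /nbhs_ballP[e /= e0 He] : \forall y \near z, 0 < H y.
    exact: (cvgr_gt (H z) (Hc _ zab)).
  have [y [yab Hy] yz] : exists2 y, E y & y < z + e.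
    by apply: inf_adherent.
  have zy : z <= y by apply: ge_inf => //; exact: infE.2.
  have : 0 < H y.
    by apply: He; rewrite /ball/= ltr_distlC; apply/andP; split; lra.
  by rewrite ltNge Hy.
have az' : a < z.
  rewrite lt_neqAle az andbT; apply/eqP => aE.
  by move: Ha; rewrite aE ltNge Hz0.
have Hz1 : H z = 0.
  apply/eqP; rewrite eq_le Hz0/= leNgt; apply/negP => Hzn.
  have Hn : \forall y \near z, H y < 0.
    exact: (cvgr_lt (H z) (Hc _ zab)).
  have [y [y1 y2 y3]] : exists y, [/\ a < y, y < z & H y < 0].
    near (z^'-) => y; exists y; split.
    - by near: y; exact: nbhs_left_gt.
    - by near: y; exact: nbhs_left_lt.
    - by near: y; exact: cvg_within.
  by move: y3; rewrite ltNge ltW// Hlt// ltW.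
have := Hz z; rewrite az' (le_trans zx xb) => /(_ isT Hz1) Hn.
have [y [y1 y2 y3]] : exists y, [/\ a < y, y < z & H y < 0].
  near (z^'-) => y; exists y; split.
  - by near: y; exact: nbhs_left_gt.
  - by near: y; exact: nbhs_left_lt.
  - by near: y.
by move: y3; rewrite ltNge ltW// Hlt// ltW.
Unshelve. all: by end_near. Qed.

(** * The profile equation and the barriers *)

(** Writing f^r / f instead of f^(r-1) leaves one power atom per exponent, which lets [field] close
    the later derivative identities. *)
Lemma is_derive_powR_comp (R : realType) (r : R) (f : R -> R) (x D : R) :
  0 < f x -> is_derive x 1 f D ->
  is_derive x 1 (fun y => f y `^ r) (r * (f x `^ r / f x) * D).
Proof.
move=> fx0 fD.
have -> : f x `^ r / f x = f x `^ (r - 1).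
  by rewrite powRB ?(gt_eqF fx0) ?implybT// powRr1// ltW.
exact: (is_derive1_comp (is_derive1_powR r fx0) fD).
Qed.

(* The profile equation as a first-order system; d stands for (f^m)', and
   f' is written d f / (m f^m). *)
Definition flow_at (R : realType) (n m p sigma al be : R) (f d : R -> R)
    (x : R) : Prop :=
  [/\ 0 < x, 0 < f x,
      is_derive x 1 f (d x * f x / (m * f x `^ m)) &
      is_derive x 1 d (al * f x + be * x * (d x * f x / (m * f x `^ m))
                       - x `^ sigma * f x `^ p - (n - 1) / x * d x)].

Lemma profile_flow_at (R : realType) (N : nat) (m p sigma : R) (f : R -> R)
    (x : R) :
  0 < m -> 0 < x -> 0 < f x -> profile_ode_at N m p sigma f x ->
  flow_at N%:R m p sigma (ss_alpha m p sigma) (ss_beta m p sigma) f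
    (derive1 (fpow m f)) x.
Proof.
move=> m0 x0 fx0 [fd gd dd ode].
have fD : is_derive x 1 f (derive1 f x) by rewrite derive1E; exact/derivableP.
have gD := is_derive_powR_comp m fx0 fD.
have F0 : 0 < f x `^ m by exact: powR_gt0.
have dE : derive1 (fpow m f) x = m * (f x `^ m / f x) * derive1 f x.
  by rewrite derive1E; case: gD.
have eE : derive1 (fpow m f) x * f x / (m * f x `^ m) = derive1 f x.
  by rewrite dE; field; rewrite !gt_eqF.
split => //; first by rewrite eE.
rewrite eE; apply: is_derive_eq; first exact: derivableP.
rewrite -derive1E; move: ode; lra.
Qed.

(* x^(1-n) times the weight m x^(n-2) f^(2m) times
   Z + (sigma+n) Y + (p+m)/2 Y^2 - X (a + b kappa Y), where d stands for (f^m)'. *)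
Definition barrier (R : realType) (n m p sigma al be a b : R) (f d : R -> R)
    (x : R) : R :=
  x * (x `^ sigma * f x `^ p * f x `^ m) + (sigma + n) * (f x `^ m * d x)
  + (p + m) / (2 * m) * (x * (d x * d x))
  - x * (a * al * (f x * f x `^ m) + b * (be / m) * (x * (f x * d x))).

(** The Pohozaev weights make the source term enter the derivative only through [B x] itself. At a
    zero of [B] the sign of the derivative is therefore that of a polynomial in [X] and [Y]. *)
Lemma is_derive_barrier (R : realType) (n m p sigma ka al a b : R)
    (f d : R -> R) (x : R) :
  0 < m -> p = m + ka * (sigma + 2) -> flow_at n m p sigma al (ka * al) f d x ->
  let B := barrier n m p sigma al (ka * al) a b f d in
  let X := al / m * (x ^+ 2 * (f x / f x `^ m)) in
  let Y := x * d x / (m * f x `^ m) in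
  let S := sigma + n in
  let M := p + m in
  is_derive x 1 B
   ((b * (ka * X) - (n - 1)) / x * B x
    + m * (f x `^ m / x) ^+ 2
      * ((m * S - (n - 2) * M / 2) * Y ^+ 2
         + X * ((1 + ka * Y) * (S + M * Y)
                - (a + b * ka * Y) * (n + (m + 1) * Y)
                + b * ka * ((n - 2 - S) * Y + (m - M / 2) * Y ^+ 2))
         + X ^+ 2 * (b * ka * (a - 1 + (b - 1) * (ka * Y))))).
Proof.
move=> m0 pE [x0 fx0 fD dD] B X Y S M.
have F0 : 0 < f x `^ m by exact: powR_gt0.
have gD := is_derive_powR_comp m fx0 fD.
have pD := is_derive_powR_comp p fx0 fD.
have iD : is_derive x 1 (@idfun R) 1 by exact: is_derive_id.
have sD := is_derive_powR_comp sigma x0 iD.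
have fgD := is_deriveM fD gD.
have QD := is_deriveM (is_deriveM sD pD) gD.
have fdD := is_deriveM fD dD.
have H1 := is_deriveM iD QD.
have H2 := is_deriveZ (sigma + n) (is_deriveM gD dD).
have H3 := is_deriveZ ((p + m) / (2 * m)) (is_deriveM iD (is_deriveM dD dD)).
have H4 := is_deriveD (is_deriveZ (a * al) fgD)
             (is_deriveZ (b * (ka * al / m)) (is_deriveM iD fdD)).
have H := is_deriveB (is_deriveD (is_deriveD H1 H2) H3) (is_deriveM iD H4).
apply: (is_derive_eq H).
rewrite /B /barrier /X /Y /S /M !fctE /= pE.
clear -m0 x0 fx0 F0.
have := gt_eqF m0; have := gt_eqF x0; have := gt_eqF fx0; have := gt_eqF F0.
have scE (r s : R) : r *: s = r * s by [].
rewrite !scE.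
move: (d x) (f x) (x `^ sigma) (f x `^ (m + ka * (sigma + 2))) (f x `^ m).
move=> v u s P F Fn0 un0 xn0 mn0.
field.
by rewrite Fn0 un0 xn0 mn0.
Qed.

(** A negative value persists by continuity, and a zero with positive slope is approached from
    below. Covering both cases lets inactive members of a max or min be treated along with active
    ones. *)
Lemma near_left_lt0 (R : realType) (G : R -> R) (x D : R) :
  is_derive x 1 G D -> G x <= 0 -> (G x = 0 -> 0 < D) ->
  \forall y \near x^'-, G y < 0.
Proof.
move=> GD; rewrite le_eqVlt => /predU1P[Gx0 /(_ Gx0)|Gx0 _].
  by move=> D0; have := derive_gt0_near_left GD D0; rewrite Gx0.
apply: cvg_within.
exact: (cvgr_lt (G x) (is_derive_continuous GD)).
Qed.

(* ka is be / al; the last inequality is p <= p_s cleared of denominators, and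
   the one before it is what makes 2m/(m+1) * n < sigma + n. *)
Definition admissible (R : realType) (n m p sigma ka al : R) : Prop :=
  [/\ 1 < m, 0 < sigma, 0 < ka, 0 < al & p = m + ka * (sigma + 2)] /\
  [/\ 1 <= n, n * (m - 1) < sigma * (m + 1)
    & (n - 2) * (p + m) <= 2 * m * (sigma + n)].

(** * Sign of the drift on the three ranges of Y *)

Definition drift (R : realType) (n m p sigma ka a b X Y : R) : R :=
  (m * (sigma + n) - (n - 2) * (p + m) / 2) * Y ^+ 2
  + X * ((1 + ka * Y) * (sigma + n + (p + m) * Y)
         - (a + b * ka * Y) * (n + (m + 1) * Y)
         + b * ka * ((n - 2 - (sigma + n)) * Y + (m - (p + m) / 2) * Y ^+ 2))
  + X ^+ 2 * (b * ka * (a - 1 + (b - 1) * (ka * Y))).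

(** The value of a with a (m + 1) = 2m: it cancels the term in 2m - a (m + 1) of the drift, both for
    Y >= 0 and for -1 <= kappa Y <= 0. *)
Definition barrier_slope (R : realType) (m : R) : R := 2 * m / (m + 1).

Lemma barrier_slope_bounds (R : realType) (m : R) :
  1 < m -> 1 < barrier_slope m < 2.
Proof.
move=> m1; have m2 : 0 < m + 1 by lra.
by rewrite /barrier_slope ltr_pdivlMr// ltr_pdivrMr//; apply/andP; split; lra.
Qed.

Lemma barrier_slope_lt (R : realType) (n m p sigma ka al : R) :
  admissible n m p sigma ka al -> barrier_slope m * n < sigma + n.
Proof.
move=> [[m1 s0 k0 al0 pE] [n1 W K]].
have m2 : 0 < m + 1 by lra.
by rewrite /barrier_slope mulrAC ltr_pdivrMr//; move: W; lra.
Qed.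

(** With b = 0 the X^2 term vanishes. The bracket multiplying X is the positive constant sigma + n -
    a n plus nonnegative multiples of Y and Y^2. *)
Lemma drift_gt0_rising (R : realType) (n m p sigma ka al X Y : R) :
  admissible n m p sigma ka al -> 0 < X -> 0 <= Y ->
  0 < drift n m p sigma ka (barrier_slope m) 0 X Y.
Proof.
move=> adm X0 Y0; have aS := barrier_slope_lt adm.
case: adm => [[m1 s0 k0 al0 pE] [n1 W K]].
have am : barrier_slope m * (m + 1) = 2 * m.
  by rewrite /barrier_slope divfK// gt_eqF//; lra.
rewrite /drift !mul0r !addr0 mulr0 addr0.
set a := barrier_slope m in aS am *.
have -> : (1 + ka * Y) * (sigma + n + (p + m) * Y) - a * (n + (m + 1) * Y)
   = (sigma + n - a * n) + ka * (sigma + 2 + (sigma + n)) * Y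
     + ka * (p + m) * Y ^+ 2 + (2 * m - a * (m + 1)) * Y by rewrite pE; ring.
rewrite am subrr mul0r addr0.
apply: ltr_wpDl.
  by apply: mulr_ge0; [lra | exact: sqr_ge0].
apply: mulr_gt0 => //.
rewrite -addrA ltr_pwDl//; first by lra.
have kn : 0 <= ka * (sigma + 2 + (sigma + n)) by apply: mulr_ge0; lra.
have kp : 0 <= ka * (p + m).
  by apply: mulr_ge0; [lra | rewrite pE; have := mulr_gt0 k0 s0; lra].
by rewrite addr_ge0// mulr_ge0// sqr_ge0.
Qed.

(** With y = kappa Y the bracket multiplying X becomes (1 + y) (sigma + n - a n) + (sigma + 2) ((1 -
    a) y + (1 - a/2) y^2), whose terms are all nonnegative since 1 < a < 2. *)
Lemma drift_gt0_falling (R : realType) (n m p sigma ka al X Y : R) :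
  admissible n m p sigma ka al -> 0 < X -> -1 <= ka * Y <= 0 ->
  0 < drift n m p sigma ka (barrier_slope m) (barrier_slope m) X Y.
Proof.
move=> adm X0 /andP[y1 y0]; have aS := barrier_slope_lt adm.
case: adm => [[m1 s0 k0 al0 pE] [n1 W K]].
have am : barrier_slope m * (m + 1) = 2 * m.
  by rewrite /barrier_slope divfK// gt_eqF//; lra.
have /andP[a1 a2] := barrier_slope_bounds m1.
rewrite /drift.
set a := barrier_slope m in aS am a1 a2 *.
set y := ka * Y in y0 y1 *.
have -> : (1 + y) * (sigma + n + (p + m) * Y) - (a + a * ka * Y) * (n + (m + 1) * Y)
    + a * ka * ((n - 2 - (sigma + n)) * Y + (m - (p + m) / 2) * Y ^+ 2)
   = (1 + y) * (sigma + n - a * n) + (1 + y) * (2 * m - a * (m + 1)) * Y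
     + (sigma + 2) * ((1 - a) * y + (1 - a / 2) * y ^+ 2).
  by rewrite pE /y; field.
rewrite am subrr mulr0 mul0r addr0.
have t1 : 0 <= (m * (sigma + n) - (n - 2) * (p + m) / 2) * Y ^+ 2.
  by apply: mulr_ge0; [lra | exact: sqr_ge0].
have t3 : 0 <= X ^+ 2 * (a * ka * (a - 1 + (a - 1) * y)).
  rewrite mulr_ge0 ?sqr_ge0// mulr_ge0//; first by rewrite mulr_ge0//; lra.
  by nra.
suff : 0 < (1 + y) * (sigma + n - a * n)
     + (sigma + 2) * ((1 - a) * y + (1 - a / 2) * y ^+ 2).
  by move/(mulr_gt0 X0); lra.
have u1 : 0 <= (1 - a) * y by nra.
have u2 : 0 <= (1 - a / 2) * y ^+ 2 by rewrite mulr_ge0 ?sqr_ge0//; lra.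
(* The first summand vanishes at y = -1 and the second at y = 0; splitting in between leaves one of
   them strictly positive on each side. *)
have [yn|yp] := leP y (-1/2).
  apply: ltr_wpDl; first by rewrite mulr_ge0//; lra.
  by rewrite mulr_gt0//; [lra | nra].
apply: ltr_pwDl; first by rewrite mulr_gt0//; lra.
by rewrite mulr_ge0//; lra.
Qed.

(** With a = b = 1 the X^2 term vanishes again, and the one product left without an evident sign, (1
    + kappa Y) Y, has two nonpositive factors. *)
Lemma drift_gt0_steep (R : realType) (n m p sigma ka al X Y : R) :
  admissible n m p sigma ka al -> 0 < X -> ka * Y <= -1 ->
  0 < drift n m p sigma ka 1 1 X Y.
Proof.
move=> [[m1 s0 k0 al0 pE] [n1 W K]] X0 y1.
rewrite /drift.
set y := ka * Y in y1 *.
have -> : (1 + y) * (sigma + n + (p + m) * Y) - (1 + 1 * ka * Y) * (n + (m + 1) * Y)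
    + 1 * ka * ((n - 2 - (sigma + n)) * Y + (m - (p + m) / 2) * Y ^+ 2)
   = (m - 1) * ((1 + y) * Y)
     + (sigma / 2 * ((1 + y) ^+ 2 + 1) + y ^+ 2).
  by rewrite pE /y; field.
rewrite !subrr mul0r addr0 mulr0 mulr0 addr0.
have Y0 : Y <= 0 by rewrite -(pmulr_rle0 _ k0) -/y; lra.
apply: ltr_wpDl.
  by apply: mulr_ge0; [lra | exact: sqr_ge0].
apply: mulr_gt0 => //.
apply: ltr_wpDl; first by apply: mulr_ge0; [lra | nra].
apply: ltr_pwDl; last exact: sqr_ge0.
by rewrite mulr_gt0 ?divr_gt0// ltr_wpDl// sqr_ge0.
Qed.

(* The three barriers agree in pairs at Y = 0 and kappa Y = -1, and the max/min
   selects [a 0] for Y >= 0, [a a] for -1 <= kappa Y <= 0, [1 1] below. *)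
Definition barrier_max (R : realType) (n m p sigma ka al : R) (f d : R -> R)
    (x : R) : R :=
  let a := barrier_slope m in
  let h := barrier n m p sigma al (ka * al) in
  Num.max (h a 0 f d x) (Num.min (h a a f d x) (h 1 1 f d x)).

(* The shift c absorbs the term of the drift proportional to the barrier itself
   when only barrier >= - c is known at the start. *)
Lemma barrier_max_near_left (R : realType) (n m p sigma ka al : R)
    (f d c : R -> R) (c' x : R) :
  admissible n m p sigma ka al ->
  flow_at n m p sigma al (ka * al) f d x ->
  is_derive x 1 c c' -> 0 <= c x -> 0 <= c' ->
  (d x <= 0 -> barrier_slope m * (ka * (al / m * (x * (f x / f x `^ m)))) * c x
               <= c') ->
  barrier_max n m p sigma ka al f d x + c x = 0 ->
  \forall y \near x^'-, barrier_max n m p sigma ka al f d y + c y < 0.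
Proof.
move=> adm flow cD c0 c'0 cc' B0.
have [[m1 s0 k0 al0 pE] [n1 W K]] := adm.
have m0 : 0 < m by lra.
have [x0 fx0 _ _] := flow.
have F0 : 0 < f x `^ m by exact: powR_gt0.
have /andP[a1 a2] := barrier_slope_bounds m1.
set a := barrier_slope m in a1 a2 cc'.
pose X := al / m * (x ^+ 2 * (f x / f x `^ m)).
pose Y := x * d x / (m * f x `^ m).
have X0 : 0 < X by rewrite !mulr_gt0 ?invr_gt0 ?exprn_gt0.
have hD b1 b2 := is_derive_barrier b1 b2 m0 pE flow.
(* Where barrier + c vanishes the barrier equals - c, so the linear term of its derivative is (n -
   1) c / x >= 0 minus a quantity at most [c']. The positive drift then makes the derivative of
   barrier + c positive. *)
have H b1 b2 : 0 <= b2 <= a -> (d x <= 0 \/ b2 = 0) ->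
    0 < drift n m p sigma ka b1 b2 X Y ->
    barrier n m p sigma al (ka * al) b1 b2 f d x + c x <= 0 ->
    \forall y \near x^'-, barrier n m p sigma al (ka * al) b1 b2 f d y + c y < 0.
  move=> /andP[b20 b2a] db dr hc.
  apply: (near_left_lt0 (is_deriveD (hD b1 b2) cD) hc) => h0.
  have -> : barrier n m p sigma al (ka * al) b1 b2 f d x = - c x.
    by rewrite -(addr0_eq (etrans (addrC _ _) h0)).
  rewrite -/X -/Y -/(drift n m p sigma ka b1 b2 X Y).
  have p1 : 0 < m * (f x `^ m / x) ^+ 2 * drift n m p sigma ka b1 b2 X Y.
    by rewrite !mulr_gt0// ?invr_gt0.
  have p2 : 0 <= (n - 1) / x * c x by rewrite mulr_ge0// divr_ge0; lra.
  have p3 : b2 * (ka * X) / x * c x <= c'.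
    have -> : b2 * (ka * X) / x = b2 * (ka * (al / m * (x * (f x / f x `^ m)))).
      by rewrite /X; field; rewrite !gt_eqF.
    case: db => [/cc'|->]; last by rewrite !mul0r.
    apply: le_trans; apply: ler_wpM2r => //; apply: ler_wpM2r => //.
    by rewrite ltW// !mulr_gt0 ?invr_gt0.
  have -> : (b2 * (ka * X) - (n - 1)) / x * - c x
    = (n - 1) / x * c x - b2 * (ka * X) / x * c x by ring.
  by move: p1 p2 p3; lra.
have fF : 0 < x * (al * (f x * f x `^ m)) by rewrite !mulr_gt0.
have uE : x * (ka * al / m * (x * (f x * d x)))
    = x * (al * (f x * f x `^ m)) * (ka * Y).
  by rewrite /Y; field; rewrite !gt_eqF.
set w := x * (al * (f x * f x `^ m)) in fF uE.
(* These differences order the three barriers at [x] according to the position of kappa Y relative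
   to -1 and 0. *)
have e1 : barrier n m p sigma al (ka * al) a 0 f d x
    - barrier n m p sigma al (ka * al) a a f d x = a * (w * (ka * Y)).
  by rewrite -uE /barrier; ring.
have e2 : barrier n m p sigma al (ka * al) 1 1 f d x
    - barrier n m p sigma al (ka * al) a a f d x = (a - 1) * (w * (1 + ka * Y)).
  by rewrite mulrDr mulr1 -uE /barrier /w; ring.
have e3 : barrier n m p sigma al (ka * al) 1 1 f d x
    - barrier n m p sigma al (ka * al) a 0 f d x = (a - 1) * w - w * (ka * Y).
  by rewrite -uE /barrier /w; ring.
have dY : (0 < d x) = (0 < Y).
  by rewrite /Y pmulr_lgt0 ?(pmulr_rgt0 _ x0)// invr_gt0 mulr_gt0.
have Yk : (0 < Y) = (0 < ka * Y) by rewrite (pmulr_rgt0 _ k0).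
have hB : barrier_max n m p sigma ka al f d x + c x <= 0 by rewrite B0.
(* For Y < 0 the (a,0) barrier lies strictly below both others, hence below the max; its shifted
   value is then strictly negative. *)
have near0 : \forall y \near x^'-,
    barrier n m p sigma al (ka * al) a 0 f d y + c y < 0.
  have h0 : barrier n m p sigma al (ka * al) a 0 f d x + c x <= 0.
    by apply: le_trans hB; rewrite lerD2r /barrier_max le_max lexx.
  have [Y0|Y0] := leP 0 Y.
    apply: (H a 0) => //; [by apply/andP; split; lra | by right |].
    exact: (drift_gt0_rising adm).
  apply: (near_left_lt0 (is_deriveD (hD a 0) cD) h0) => /= h00; exfalso.
  have {}h00 := addr0_eq h00.
  have kY : ka * Y < 0 by rewrite pmulr_rlt0.
  have wY : w * (ka * Y) < 0 by rewrite pmulr_rlt0.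
  have aw : 0 < (a - 1) * w by rewrite mulr_gt0// subr_gt0.
  have awY : a * (w * (ka * Y)) < 0 by rewrite pmulr_rlt0//; lra.
  have : barrier n m p sigma al (ka * al) a 0 f d x
         < barrier_max n m p sigma ka al f d x.
    rewrite /barrier_max lt_max lt_min -/a /=; apply/orP; right; apply/andP; split.
      by rewrite -subr_lt0 e1.
    by rewrite -subr_gt0 e3; lra.
  by lra.
have hmin : Num.min (barrier n m p sigma al (ka * al) a a f d x)
    (barrier n m p sigma al (ka * al) 1 1 f d x) + c x <= 0.
  by apply: le_trans hB; rewrite lerD2r /barrier_max le_max lexx orbT.
(* This decides which argument realises the min: (1,1) if kappa Y <= -1, and (a,a) otherwise. *)
have [yk|yk] := leP (ka * Y) (-1).
  have near1 : \forall y \near x^'-,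
      barrier n m p sigma al (ka * al) 1 1 f d y + c y < 0.
    apply: H.
    - by rewrite ler01 ltW.
    - by left; rewrite leNgt dY Yk; lra.
    - exact: (drift_gt0_steep adm).
    apply: le_trans hmin; rewrite lerD2r le_min lexx andbT.
    rewrite -subr_le0 e2 pmulr_rle0 ?subr_gt0// pmulr_rle0//; lra.
  near=> y.
  have n0 : barrier n m p sigma al (ka * al) a 0 f d y + c y < 0 by near: y.
  have n1' : barrier n m p sigma al (ka * al) 1 1 f d y + c y < 0 by near: y.
  by rewrite -ltrBrDr gt_max gt_min -/a; apply/andP; split;
    [|apply/orP; right]; lra.
have neara : \forall y \near x^'-,
    barrier n m p sigma al (ka * al) a a f d y + c y < 0.
  have ha : barrier n m p sigma al (ka * al) a a f d x + c x <= 0.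
    apply: le_trans hmin; rewrite lerD2r le_min lexx /=.
    rewrite -subr_ge0 e2 mulr_ge0 ?subr_ge0 ?ltW// mulr_gt0//; lra.
  (* For Y > 0 the (a,a) barrier lies strictly below the (a,0) one, which is at most - c. *)
  have [Y0|Y0] := ltP 0 Y; last first.
    apply: H => //.
    - by rewrite lexx andbT; lra.
    - by left; rewrite leNgt dY -leNgt.
    - apply: (drift_gt0_falling adm) => //.
      by rewrite (ltW yk)/= pmulr_rle0.
  apply: (near_left_lt0 (is_deriveD (hD a a) cD) ha) => /= h00; exfalso.
  have {}h00 := addr0_eq h00.
  have h0 : barrier n m p sigma al (ka * al) a 0 f d x + c x <= 0.
    by apply: le_trans hB; rewrite lerD2r /barrier_max le_max lexx.
  have a0 : 0 < a by lra.
  have awY : 0 < a * (w * (ka * Y)) by rewrite mulr_gt0// mulr_gt0// mulr_gt0.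
  by move: awY; rewrite -e1; lra.
near=> y.
have n0 : barrier n m p sigma al (ka * al) a 0 f d y + c y < 0 by near: y.
have n1' : barrier n m p sigma al (ka * al) a a f d y + c y < 0 by near: y.
by rewrite -ltrBrDr gt_max gt_min -/a; apply/andP; split;
  [|apply/orP; left]; lra.
Unshelve. all: by end_near. Qed.

Lemma barrier_max_continuous (R : realType) (n m p sigma ka al : R)
    (f d : R -> R) (x : R) :
  admissible n m p sigma ka al -> flow_at n m p sigma al (ka * al) f d x ->
  {for x, continuous (barrier_max n m p sigma ka al f d)}.
Proof.
move=> [[m1 s0 k0 al0 pE] _] flow.
have m0 : 0 < m by lra.
have hc b1 b2 : {for x, continuous (barrier n m p sigma al (ka * al) b1 b2 f d)}.
  exact: is_derive_continuous (is_derive_barrier b1 b2 m0 pE flow).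
apply: (@continuous_max _ _ (barrier n m p sigma al (ka * al) _ _ f d)
  (fun y => Num.min (barrier n m p sigma al (ka * al) _ _ f d y) _)) => //.
exact: continuous_min.
Qed.

(** The shift [c] will be zero for plain propagation, constant next to a zero of [f], and affine
    next to an origin where [f] is positive. *)
Lemma barrier_max_gt0_forward (R : realType) (n m p sigma ka al : R)
    (f d c c' : R -> R) (x0 x1 : R) :
  admissible n m p sigma ka al ->
  (forall x, x0 <= x <= x1 -> flow_at n m p sigma al (ka * al) f d x) ->
  (forall x, x0 <= x <= x1 -> is_derive x 1 c (c' x)) ->
  (forall x, x0 <= x <= x1 -> 0 <= c x) ->
  (forall x, x0 <= x <= x1 -> 0 <= c' x) ->
  (forall x, x0 <= x <= x1 -> d x <= 0 ->
    barrier_slope m * (ka * (al / m * (x * (f x / f x `^ m)))) * c x <= c' x) ->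
  0 < barrier_max n m p sigma ka al f d x0 + c x0 ->
  forall x, x0 <= x <= x1 -> 0 < barrier_max n m p sigma ka al f d x + c x.
Proof.
move=> adm flow cD c0 c'0 cc' h0.
apply: (@first_zero_gt0 _ (fun x => barrier_max n m p sigma ka al f d x + c x)).
- move=> x x01; apply: continuousD.
    exact: barrier_max_continuous (flow _ x01).
  exact: is_derive_continuous (cD _ x01).
- exact: h0.
move=> x /andP[/ltW x0x xx1] hx.
have x01 : x0 <= x <= x1 by rewrite x0x xx1.
exact: (barrier_max_near_left adm (flow _ x01) (cD _ x01) (c0 _ x01) (c'0 _ x01)
  (cc' _ x01)).
Qed.

Lemma barrier_max_gt0_stays (R : realType) (n m p sigma ka al : R)
    (f d : R -> R) (x0 : R) :
  admissible n m p sigma ka al ->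
  (forall x, x0 <= x -> flow_at n m p sigma al (ka * al) f d x) ->
  0 < barrier_max n m p sigma ka al f d x0 ->
  forall x, x0 <= x -> 0 < barrier_max n m p sigma ka al f d x.
Proof.
move=> adm flow h0 x x0x.
rewrite -[ltRHS]addr0.
apply: (@barrier_max_gt0_forward _ n m p sigma ka al f d (cst 0) (cst 0) x0 x)
  => //=.
- by move=> y /andP[/flow].
- by move=> y _ _; rewrite mulr0.
- by rewrite addr0.
- by rewrite x0x lexx.
Qed.

(** When d <= 0 the (1,1) barrier is at least the (a,0) one, so it is positive whichever argument
    makes the max positive. *)
Lemma barrier_steep_gt0 (R : realType) (n m p sigma ka al : R)
    (f d : R -> R) (x : R) :
  admissible n m p sigma ka al -> flow_at n m p sigma al (ka * al) f d x ->
  d x <= 0 -> 0 < barrier_max n m p sigma ka al f d x ->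
  0 < barrier n m p sigma al (ka * al) 1 1 f d x.
Proof.
move=> [[m1 s0 k0 al0 pE] _] [x0 fx0 _ _] dx0.
have m0 : 0 < m by lra.
have /andP[a1 a2] := barrier_slope_bounds m1.
have F0 : 0 < f x `^ m by exact: powR_gt0.
rewrite /barrier_max lt_max lt_min => /orP[|/andP[]//].
move=> /lt_le_trans; apply; rewrite -subr_ge0.
set a := barrier_slope m in a1 a2 *.
have -> : barrier n m p sigma al (ka * al) 1 1 f d x
    - barrier n m p sigma al (ka * al) a 0 f d x
  = (a - 1) * (x * (al * (f x * f x `^ m)))
    + x * (ka * al / m * (x * (f x * - d x))) by rewrite /barrier; ring.
by rewrite addr_ge0// !mulr_ge0 ?invr_ge0 ?(ltW x0) ?(ltW F0) ?(ltW fx0)//; lra.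
Qed.

Lemma derive_ge0_le (R : realType) (F F' : R -> R) (a b : R) :
  a <= b -> (forall x, a <= x <= b -> is_derive x 1 F (F' x)) ->
  (forall x, a <= x <= b -> 0 <= F' x) -> F a <= F b.
Proof.
move=> ab FD F'0.
have [c cab Fab] : exists2 c, c \in `[a, b]%R & F b - F a = F' c * (b - a).
  apply: MVT_segment => //.
    by move=> x; rewrite in_itv/= => /andP[ax xb]; apply: FD; rewrite !ltW.
  by apply: derivable_within_continuous => x; rewrite in_itv/= => /FD[].
rewrite -subr_ge0 Fab mulr_ge0 ?subr_ge0//.
by apply: F'0; move: cab; rewrite in_itv.
Qed.

(** * Decay after the maximum *)

(** Where d = 0, positivity of the (1,1) barrier reads x^sigma f^p > alpha f, that is d' < 0. So [d]
    can only cross 0 downwards. *)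
Lemma slope_stays_negative (R : realType) (n m p sigma ka al : R)
    (f d : R -> R) (x0 : R) :
  admissible n m p sigma ka al ->
  (forall x, x0 <= x -> flow_at n m p sigma al (ka * al) f d x) ->
  (forall x, x0 <= x -> 0 < barrier_max n m p sigma ka al f d x) ->
  d x0 < 0 -> forall x, x0 <= x -> d x < 0.
Proof.
move=> adm flow bm dx0 x x0x.
have [[m1 s0 k0 al0 pE] _] := adm.
have m0 : 0 < m by lra.
rewrite -oppr_gt0.
apply: (@first_zero_gt0 _ (fun y => - d y) x0 x).
- move=> y /andP[x0y _]; apply: continuousN.
  by have [_ _ _ dD] := flow _ x0y; exact: is_derive_continuous dD.
- by rewrite oppr_gt0.
- move=> y /andP[/ltW x0y _] dy.
  have {}dy : d y = 0 by rewrite -[d y]opprK dy oppr0.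
  have [y0 fy0 _ dD] := flow _ x0y.
  apply: (near_left_lt0 (is_deriveN dD)).
    by have : - d y <= 0 by rewrite dy oppr0.
  move=> _; rewrite dy !mul0r !mulr0 subr0 addr0 opprB subr_gt0.
  have := barrier_steep_gt0 adm (flow _ x0y); rewrite dy lexx => /(_ isT (bm _ x0y)).
  rewrite /barrier dy !mulr0 !addr0 mul1r.
  have F0 : 0 < f y `^ m by exact: powR_gt0.
  rewrite (_ : _ - _ = y * f y `^ m * (y `^ sigma * f y `^ p - al * f y)).
    by rewrite pmulr_rgt0 ?subr_gt0// mulr_gt0.
  by ring.
- by rewrite x0x lexx.
Qed.

(* Its derivative is a positive multiple of [barrier 1 1]. *)
Definition steepness (R : realType) (m p sigma : R) (f d : R -> R) (y : R) : R :=
  - d y * (f y `^ (- ((p + m) / 2)) * y `^ (- (sigma + 1))).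

Lemma steepness_nondecreasing (R : realType) (n m p sigma ka al : R)
    (f d : R -> R) (x0 x : R) :
  0 < m -> p = m + ka * (sigma + 2) ->
  (forall y, x0 <= y -> flow_at n m p sigma al (ka * al) f d y) ->
  (forall y, x0 <= y -> 0 < barrier n m p sigma al (ka * al) 1 1 f d y) ->
  x0 <= x ->
  steepness m p sigma f d x0 <= steepness m p sigma f d x.
Proof.
move=> m0 pE flow b1 x0x.
pose P' y := f y `^ (- ((p + m) / 2)) * y `^ (- (sigma + 1))
  * (barrier n m p sigma al (ka * al) 1 1 f d y / (y * f y `^ m)).
apply: (@derive_ge0_le _ (steepness m p sigma f d) P') => //.
  move=> y /andP[/flow[y0 fy0 fD dD] _].
  have F0 : 0 < f y `^ m by exact: powR_gt0.
  have iD : is_derive y 1 (@idfun R) 1 by exact: is_derive_id.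
  have H1 := is_derive_powR_comp (- ((p + m) / 2)) fy0 fD.
  have H2 := is_derive_powR_comp (- (sigma + 1)) y0 iD.
  apply: (is_derive_eq (is_deriveM (is_deriveN dD) (is_deriveM H1 H2))).
  have scE (r s : R) : r *: s = r * s by [].
  rewrite !fctE /= !scE /P' /barrier.
  have := gt_eqF m0; have := gt_eqF y0; have := gt_eqF fy0; have := gt_eqF F0.
  move: (f y `^ (- ((p + m) / 2))) (y `^ (- (sigma + 1))).
  move: (d y) (f y) (y `^ sigma) (f y `^ p) (f y `^ m).
  move=> v u s Pp F A B Fn0 un0 xn0 mn0.
  field.
  by rewrite Fn0 un0 xn0 mn0.
move=> y /andP[x0y _]; have [y0 fy0 _ _] := flow _ x0y.
by rewrite /P' !mulr_ge0 ?invr_ge0 ?mulr_ge0 ?powR_ge0 ?ltW// b1.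
Qed.

(** The derivative of f^(-(p-m)/2) is (p-m)/(2m) x^(sigma+1) times [steepness]; the bound integrates
    this from [x0], dropping the positive initial value. *)
Lemma steep_growth (R : realType) (n m p sigma ka al : R)
    (f d : R -> R) (x0 c : R) :
  0 < m -> 0 < sigma -> m < p ->
  (forall y, x0 <= y -> flow_at n m p sigma al (ka * al) f d y) ->
  (forall y, x0 <= y -> c <= steepness m p sigma f d y) ->
  forall x, x0 <= x ->
  (p - m) / (2 * m) * c / (sigma + 2) * (x `^ (sigma + 2) - x0 `^ (sigma + 2)) <= f x `^ (- ((p - m) / 2)).
Proof.
move=> m0 s0 mp flow hc x x0x.
pose r := (p - m) / (2 * m) * c / (sigma + 2); rewrite -/r.
pose G y := f y `^ (- ((p - m) / 2)) - r * y `^ (sigma + 2).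
pose G' y := (p - m) / (2 * m) * y `^ (sigma + 1)
  * (steepness m p sigma f d y - c).
have : G x0 <= G x.
  apply: (@derive_ge0_le _ G G') => //.
    move=> y /andP[/flow[y0 fy0 fD dD] _].
    have F0 : 0 < f y `^ m by exact: powR_gt0.
    have iD : is_derive y 1 (@idfun R) 1 by exact: is_derive_id.
    have H1 := is_derive_powR_comp (- ((p - m) / 2)) fy0 fD.
    have H2 := is_derive_powR_comp (sigma + 2) y0 iD.
    apply: (is_derive_eq (is_deriveB H1 (is_deriveZ r H2))).
    have scE (a b : R) : a *: b = a * b by [].
    rewrite scE /G' /steepness (powRN y).
    have -> : y `^ (sigma + 2) = y `^ (sigma + 1) * y.
      rewrite -[X in _ = _ * X]powRr1 ?ltW// -powRD; last first.
        by rewrite (gt_eqF y0) implybT.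
      by congr (_ `^ _); ring.
    have -> : f y `^ (- ((p - m) / 2)) = f y `^ (- ((p + m) / 2)) * f y `^ m.
      rewrite -powRD; last by rewrite (gt_eqF fy0) implybT.
      by congr (_ `^ _); field.
    have Y0 : 0 < y `^ (sigma + 1) by exact: powR_gt0.
    rewrite /r.
    have s2 : 0 < sigma + 2 by lra.
    move: (gt_eqF m0) (gt_eqF y0) (gt_eqF fy0) (gt_eqF F0) (gt_eqF Y0) (gt_eqF s2).
    move: (y `^ (sigma + 1)) (d y) (f y `^ (- ((p + m) / 2))) (f y `^ m) (f y).
    move=> Y v A F u h1 h2 h3 h4 h5 h6.
    field.
    by rewrite h1 h2 h3 h4 h5 h6.
  move=> y /andP[x0y _].
  rewrite /G' mulr_ge0 ?subr_ge0 ?hc// mulr_ge0 ?powR_ge0// divr_ge0//; lra.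
rewrite /G mulrBr.
have : 0 <= f x0 `^ (- ((p - m) / 2)) by exact: powR_ge0.
lra.
Qed.

(** In the variable t = x^(s/2) the inequality bounds a quadratic by a linear function, which fails
    for large t. *)
Lemma no_steep_tail (R : realType) (s r A B x0 : R) :
  0 < s -> 0 < r -> 0 <= B ->
  (forall x, x0 <= x -> r * (x `^ s - A) <= B * x `^ (s / 2)) -> False.
Proof.
move=> s0 r0 B0 H.
(* The first three summands give t^2 - (B/r) t >= (1 + |A|) t > A; the last one ensures x0 <= x. *)
pose t := 1 + `|A| + B / r + `|x0| `^ (s / 2).
have Br : 0 <= B / r by rewrite divr_ge0// ltW.
have A0 : 0 <= `|A| by [].
have X0 : 0 <= `|x0| `^ (s / 2) by exact: powR_ge0.
have t1 : 1 <= t by rewrite /t; lra.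
have t0 : 0 <= t by lra.
have s2 : 0 < s / 2 by lra.
pose x := t `^ (2 / s).
have xs : x `^ (s / 2) = t.
  rewrite /x -powRrM (_ : 2 / s * (s / 2) = 1) ?powRr1//.
  by field; rewrite gt_eqF.
have xs' : x `^ s = t ^+ 2.
  by rewrite -[s](@divfK _ 2) ?pnatr_eq0// powRrM xs powR_mulrn.
have x0x : x0 <= x.
  rewrite leNgt; apply/negP => xx0.
  have x0' : 0 <= x by exact: powR_ge0.
  have : x `^ (s / 2) <= `|x0| `^ (s / 2).
    apply: ge0_ler_powR; rewrite ?nnegrE ?normr_ge0// ltW//.
    exact: lt_le_trans (ler_norm _).
  by rewrite xs /t; lra.
have := H _ x0x; rewrite xs xs' -(ler_pM2l (_ : 0 < r^-1)) ?invr_gt0//.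
rewrite mulrA mulVf ?gt_eqF// mul1r mulrA (mulrC _ B) => h.
have : (1 + `|A|) * t <= t ^+ 2 - B / r * t.
  have : 1 + `|A| <= t - B / r by rewrite /t; lra.
  by move=> /(ler_wpM2r t0); rewrite mulrBl expr2.
have := ler_norm A; nra.
Qed.

(** * Behaviour at the start of the last positivity component *)

(** A zero would be preceded by negative values. This recovers the strict sign lost when the shift
    is made arbitrarily small. *)
Lemma barrier_max_ge0_gt0 (R : realType) (n m p sigma ka al : R)
    (f d : R -> R) (x0 x : R) :
  admissible n m p sigma ka al -> x0 < x ->
  flow_at n m p sigma al (ka * al) f d x ->
  (forall y, x0 < y <= x -> 0 <= barrier_max n m p sigma ka al f d y) ->
  0 < barrier_max n m p sigma ka al f d x.
Proof.
move=> adm x0x flow bm; rewrite lt_neqAle bm ?x0x ?lexx// andbT eq_sym.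
apply/eqP => bmx.
have near0 : \forall y \near x^'-, barrier_max n m p sigma ka al f d y + 0 < 0.
  apply: (@barrier_max_near_left _ _ _ _ _ _ _ _ _ (cst 0) 0 _ adm flow) => //=.
    by rewrite mulr0.
  by rewrite addr0.
have [y [y1 y2 y3]] : exists y, [/\ x0 < y, y < x
    & barrier_max n m p sigma ka al f d y + 0 < 0].
  near (x^'-) => y; exists y; split.
  - by near: y; exact: nbhs_left_gt.
  - by near: y; exact: nbhs_left_lt.
  - by near: y.
by move: y3; rewrite addr0 ltNge bm// y1 ltW.
Unshelve. all: by end_near. Qed.

Lemma barrier_max_ge_rising (R : realType) (n m p sigma ka al : R)
    (f d : R -> R) (x : R) :
  0 < m -> 0 < p -> 0 < x ->
  (sigma + n) * (f x `^ m * d x)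
    - x * (barrier_slope m * al * (f x * f x `^ m))
  <= barrier_max n m p sigma ka al f d x.
Proof.
move=> m0 p0 x0; rewrite /barrier_max le_max; apply/orP; left.
rewrite /barrier !mul0r addr0 lerD2r -[leLHS]addr0.
apply: lerD.
  by rewrite lerDr !mulr_ge0 ?powR_ge0// ltW.
rewrite mulr_ge0//; first by rewrite divr_ge0//; lra.
by rewrite mulr_ge0 ?(ltW x0)// -expr2 sqr_ge0.
Qed.

Lemma exists_small_powR (R : realType) (r e : R) :
  0 < r -> 0 < e -> exists2 t, 0 < t & forall u, 0 <= u < t -> u `^ r < e.
Proof.
move=> r0 e0; exists (e `^ r^-1); first exact: powR_gt0.
move=> u /andP[u0 ut].
have -> : e = (e `^ r^-1) `^ r by rewrite -powRrM mulVf ?gt_eqF// powRr1// ltW.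
by apply: gt0_ltr_powR; rewrite ?nnegrE ?powR_ge0.
Qed.

Lemma near_rightP (R : realType) (x0 : R) (P : R -> Prop) :
  (\forall x \near x0^'+, P x) ->
  exists2 e, 0 < e & forall x, x0 < x < x0 + e -> P x.
Proof.
rewrite near_withinE => /nbhs_ballP[e /= e0 He]; exists e => // x /andP[x0x xe].
by apply: He => //; rewrite /ball/= ltr_distlC; apply/andP; split; lra.
Qed.

Lemma slope_sign_between (R : realType) (n m p sigma al be : R) (f d : R -> R)
    (x y : R) :
  0 < m -> x < y ->
  (forall z, x <= z <= y -> flow_at n m p sigma al be f d z) ->
  f x != f y -> exists2 c, x < c < y & 0 < d c * (f y - f x).
Proof.
move=> m0 xy flow fxy.
pose e z := d z * f z / (m * f z `^ m).
have [c cxy fE] : exists2 c, c \in `]x, y[%R & f y - f x = e c * (y - x).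
  apply: MVT => //.
    move=> z; rewrite in_itv/= => /andP[/ltW xz /ltW zy].
    by have [] := flow z; rewrite ?xz.
  apply: derivable_within_continuous => z; rewrite in_itv/= => /flow[_ _ fD _].
  by case: fD.
move: cxy; rewrite in_itv/= => /andP[xc cy]; exists c; first by rewrite xc.
have [_ fc0 _ _] : flow_at n m p sigma al be f d c by apply: flow; rewrite !ltW.
have F0 : 0 < f c `^ m by exact: powR_gt0.
have -> : d c * (f y - f x) = (f y - f x) ^+ 2 * (m * f c `^ m / (f c * (y - x))).
  rewrite expr2 {2}fE /e; field.
  by rewrite !gt_eqF// subr_gt0.
apply: mulr_gt0; first by rewrite exprn_even_gt0//= subr_eq0 eq_sym.
by apply: divr_gt0; apply: mulr_gt0; rewrite ?subr_gt0.
Qed.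

(** Since p > 1, the source is smaller than alpha f while [f] is small, so d' > 0 wherever d = 0 and
    [d] can only cross 0 upwards. As [f] leaves 0, the mean value theorem gives points with d > 0
    arbitrarily close to [x0]. *)
Lemma rising_after_zero (R : realType) (n m p sigma al be : R)
    (f d : R -> R) (x0 : R) :
  0 < m -> 1 < p -> 0 < sigma -> 0 < al -> 0 <= x0 ->
  (forall x, x0 < x -> flow_at n m p sigma al be f d x) ->
  f y @[y --> x0^'+] --> 0 ->
  \forall x \near x0^'+, 0 < d x.
Proof.
move=> m0 p1 s0 al0 x00 flow f0.
have K0 : 0 < (x0 + 1) `^ sigma by apply: powR_gt0; lra.
have p10 : 0 < p - 1 by lra.
have [t t0 ht] := exists_small_powR p10 (divr_gt0 al0 K0).
have [e e0 he] := near_rightP (cvgr_lt 0 f0 _ t0).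
have source x : x0 < x -> x < x0 + e -> x < x0 + 1 ->
    x `^ sigma * f x `^ p < al * f x.
  move=> x0x xe x1; have [xp fx0 _ _] := flow _ x0x.
  have -> : f x `^ p = f x `^ (p - 1) * f x.
    rewrite -[X in _ = _ * X]powRr1 ?ltW// -powRD ?(gt_eqF fx0) ?implybT//.
    by congr (_ `^ _); ring.
  rewrite mulrA ltr_pM2r//.
  have h1 : f x `^ (p - 1) < al / (x0 + 1) `^ sigma.
    by apply: ht; rewrite ltW//= he// x0x.
  have h2 : x `^ sigma <= (x0 + 1) `^ sigma.
    by apply: ge0_ler_powR; rewrite ?nnegrE; lra.
  apply: (@le_lt_trans _ _ ((x0 + 1) `^ sigma * f x `^ (p - 1))).
    by rewrite ler_wpM2r// powR_ge0.
  by rewrite mulrC -ltr_pdivlMr.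
near=> x.
have x0x : x0 < x by near: x; exact: nbhs_right_gt.
have xe : x < x0 + e by near: x; apply: nbhs_right_lt; lra.
have x1 : x < x0 + 1 by near: x; apply: nbhs_right_lt; lra.
have [xp fx0 _ _] := flow _ x0x.
have [z [x0z zx fzx]] : exists z, [/\ x0 < z, z < x & f z < f x].
  near (x0^'+) => z; exists z; split.
  - by near: z; exact: nbhs_right_gt.
  - by near: z; exact: nbhs_right_lt.
  - by near: z; exact: (cvgr_lt 0 f0).
have [c /andP[zc cx] dc] : exists2 c, z < c < x & 0 < d c.
  have flow' y : z <= y <= x -> flow_at n m p sigma al be f d y.
    by move=> /andP[zy _]; apply: flow; exact: lt_le_trans zy.
  have [c zcx] := slope_sign_between m0 zx flow' (negbT (lt_eqF fzx)).
  by rewrite pmulr_lgt0 ?subr_gt0//; exists c.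
have x0c := lt_trans x0z zc.
apply: (@first_zero_gt0 _ d c x) => //.
- move=> y /andP[cy _].
  by have [_ _ _ dD] := flow _ (lt_le_trans x0c cy); exact: is_derive_continuous dD.
- move=> y /andP[cy yx] dy.
  have x0y := lt_trans x0c cy.
  have [y0 fy0 _ dD] := flow _ x0y.
  apply: (near_left_lt0 dD); first by rewrite dy.
  move=> _; rewrite dy !mul0r !mulr0 subr0 addr0 subr_gt0.
  by apply: source => //; exact: le_lt_trans yx _.
- by rewrite (ltW cx) lexx.
Unshelve. all: by end_near. Qed.

(** If the glued barrier were - eps < 0 at some x, it would exceed - eps at a point close enough to
    [x0], where [f] is small and d > 0; propagating barrier + eps up to x is a contradiction. *)
Lemma barrier_starts_at_zero (R : realType) (n m p sigma ka al : R)
    (f d : R -> R) (x0 : R) :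
  admissible n m p sigma ka al -> 0 <= x0 ->
  (forall x, x0 < x -> flow_at n m p sigma al (ka * al) f d x) ->
  f y @[y --> x0^'+] --> 0 ->
  exists2 x1, x0 < x1 & 0 < barrier_max n m p sigma ka al f d x1.
Proof.
move=> adm x00 flow f0.
have [[m1 s0 k0 al0 pE] [n1 _ _]] := adm.
have m0 : 0 < m by lra.
have p1 : 1 < p by rewrite pE; have := mulr_gt0 k0 s0; lra.
have /andP[a1 _] := barrier_slope_bounds m1.
have a0 := lt_trans ltr01 a1.
have [e e0 dpos] := near_rightP (rising_after_zero m0 p1 s0 al0 x00 flow f0).
have ge0 x : x0 < x < x0 + e -> 0 <= barrier_max n m p sigma ka al f d x.
  move=> /andP[x0x xe]; rewrite leNgt; apply/negP => bmx.
  pose eps := - barrier_max n m p sigma ka al f d x.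
  have eps0 : 0 < eps by rewrite oppr_gt0.
  pose K := (x0 + e) * (barrier_slope m * al).
  have K0 : 0 < K by apply: mulr_gt0; [lra | exact: mulr_gt0].
  have mm0 : 0 < m + 1 by lra.
  have [t t0 ht] := exists_small_powR mm0 (divr_gt0 eps0 K0).
  have [z [x0z zx fz]] : exists z, [/\ x0 < z, z < x & f z < t].
    near (x0^'+) => z; exists z; split.
    - by near: z; exact: nbhs_right_gt.
    - by near: z; exact: nbhs_right_lt.
    - by near: z; exact: (cvgr_lt 0 f0).
  have inz y : z <= y <= x -> x0 < y /\ y < x0 + e.
    by move=> /andP[zy yx]; split; [exact: lt_le_trans zy | exact: le_lt_trans xe].
  have : 0 < barrier_max n m p sigma ka al f d x + eps.
    apply: (@barrier_max_gt0_forward _ n m p sigma ka al f d (cst eps) (cst 0) z x)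
      => //.
    - by move=> y /inz[/flow].
    - by move=> y _; exact: ltW.
    (* The condition on the shift concerns d <= 0 only, which is excluded here, so a constant shift
       suffices. *)
    - move=> y /inz[x0y ye]; rewrite leNgt dpos// x0y//.
    - have [z0 fz0 _ _] := flow _ x0z.
      have dz : 0 < d z by apply: dpos; rewrite x0z (lt_trans zx).
      have fF : f z * f z `^ m = f z `^ (m + 1).
        rewrite -[X in X * _]powRr1 ?ltW// -powRD ?(gt_eqF fz0) ?implybT//.
        by congr (_ `^ _); ring.
      have := @barrier_max_ge_rising _ n m p sigma ka al f d z m0 (lt_trans ltr01 p1) z0.
      have : 0 <= (sigma + n) * (f z `^ m * d z).
        by rewrite !mulr_ge0 ?powR_ge0 ?ltW//; lra.
      have : z * (barrier_slope m * al * (f z * f z `^ m)) < eps.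
        have hz : f z `^ (m + 1) < eps / K by apply: ht; rewrite ltW.
        rewrite fF mulrA; apply: (@le_lt_trans _ _ (K * f z `^ (m + 1))).
          rewrite ler_wpM2r ?powR_ge0// /K ler_wpM2r//; last lra.
          by apply: mulr_ge0; exact: ltW.
        by rewrite mulrC -ltr_pdivlMr.
      rewrite /cst; lra.
    - by rewrite lexx (ltW zx).
  by rewrite /eps subrr ltxx.
exists (x0 + e / 2); first by lra.
apply: (barrier_max_ge0_gt0 adm (x0 := x0)); first by lra.
  by apply: flow; lra.
by move=> y /andP[x0y ye]; apply: ge0; apply/andP; split; lra.
Unshelve. all: by end_near. Qed.

(** The scheme is that of [barrier_starts_at_zero], but the sign of [d] near the origin is unknown.
    The shift therefore grows, as eps (1 + 2 C x): its slope 2 C eps dominates C times the shift as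
    long as 2 C x <= 1. *)
Lemma barrier_starts_positive (R : realType) (n m p sigma ka al : R)
    (f d : R -> R) :
  admissible n m p sigma ka al ->
  (forall x, 0 < x -> flow_at n m p sigma al (ka * al) f d x) ->
  {within `[0, +oo[, continuous f} -> 0 < f 0 ->
  (f h - f 0) / h @[h --> 0^'+] --> (0 : R) ->
  exists2 x1, 0 < x1 & 0 < barrier_max n m p sigma ka al f d x1.
Proof.
move=> adm flow fc; set A := f 0 => A0 df0.
have [[m1 s0 k0 al0 pE] [n1 _ _]] := adm.
have m0 : 0 < m by lra.
have p0 : 0 < p by rewrite pE; have := mulr_gt0 k0 s0; lra.
have /andP[a1 _] := barrier_slope_bounds m1.
have a0 := lt_trans ltr01 a1.
have fA : f x @[x --> 0^'+] --> A.
  by move/continuous_within_itvcyP : fc => [].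
have f_lower : \forall x \near 0^'+, A / 2 < f x by apply: (cvgr_gt A fA); lra.
have f_upper : \forall x \near 0^'+, f x < 2 * A by apply: (cvgr_lt A fA); lra.
have [e1 e10 he1] := near_rightP f_lower.
have [e2 e20 he2] := near_rightP f_upper.
pose Fl := (A / 2) `^ m.
pose Fu := (2 * A) `^ m.
have Fl0 : 0 < Fl by apply: powR_gt0; lra.
have Fu0 : 0 < Fu by apply: powR_gt0; lra.
(* An upper bound for the coefficient of the shift when x <= 1 and A/2 < f < 2A. *)
pose C := barrier_slope m * (ka * (al / m * (2 * A / Fl))).
have C0 : 0 < C.
  apply: mulr_gt0 => //; rewrite mulr_gt0// mulr_gt0 ?divr_gt0//; lra.
pose e := Num.min (Num.min e1 e2) (Num.min 1 (2 * C)^-1).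
have e0 : 0 < e by rewrite !lt_min e10 e20 ltr01/= invr_gt0 mulr_gt0.
have small x : 0 < x < e ->
    [/\ A / 2 < f x < 2 * A, x <= 1, 2 * (C * x) <= 1 & Fl <= f x `^ m <= Fu].
  rewrite !lt_min => /and3P[x0 /andP[xe1 xe2] /andP[x1 xC]].
  have fl : A / 2 < f x by apply: he1; rewrite x0 add0r.
  have fu : f x < 2 * A by apply: he2; rewrite x0 add0r.
  split; [by rewrite fl| exact: ltW | |].
    have C2 : 0 < 2 * C by exact: mulr_gt0.
    by move: (ltW xC); rewrite -(ler_pM2l C2) divff ?gt_eqF// mulrA.
  by apply/andP; split; apply: ge0_ler_powR; rewrite ?nnegrE; lra.
have ge0 x : 0 < x < e -> 0 <= barrier_max n m p sigma ka al f d x.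
  move=> /andP[x0 xe]; rewrite leNgt; apply/negP => bmx.
  (* Half the defect, because the shift may double on the way to [x]. *)
  pose eps := - barrier_max n m p sigma ka al f d x / 2.
  have eps0 : 0 < eps by rewrite divr_gt0// oppr_gt0.
  pose K := barrier_slope m * al * (2 * A * Fu).
  have K0 : 0 < K by apply: mulr_gt0; apply: mulr_gt0 => //; lra.
  pose K' := (sigma + n) * (Fu * (m * Fu / (A / 2))).
  have K'0 : 0 < K' by rewrite !mulr_gt0 ?invr_gt0//; lra.
  have eta0 : 0 < eps / (2 * K') by rewrite divr_gt0// mulr_gt0.
  (* Since f'(0) = 0, the mean value theorem on [0, h] gives a point z with f'(z) > - eps / (2 K').
     As [K'] bounds the factor of f' and [K] that of x, each term of [barrier_max_ge_rising] at z
     loses at most eps/2. *)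
  have [h [h0 hx hK hd]] : exists h, [/\ 0 < h, h < x, h < eps / (2 * K) &
      - (eps / (2 * K')) < (f h - f 0) / h].
    near (0 : R)^'+ => h; exists h; split.
    - by near: h; exact: nbhs_right_gt.
    - by near: h; exact: nbhs_right_lt.
    - by near: h; apply: nbhs_right_lt; rewrite divr_gt0// mulr_gt0.
    - by near: h; apply: (cvgr_gt 0 df0); rewrite oppr_lt0.
  pose fd z := d z * f z / (m * f z `^ m).
  have [z zh fE] : exists2 z, z \in `]0, h[%R & f h - f 0 = fd z * (h - 0).
    apply: MVT => //.
      by move=> z; rewrite in_itv/= => /andP[/flow[]].
    by apply: continuous_subspaceW fc => y /=; rewrite !in_itv/= => /andP[->].
  move: zh; rewrite in_itv/= => /andP[z0 zh].
  have {}hd : - (eps / (2 * K')) < fd z.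
    by move: hd; rewrite fE subr0 mulfK// gt_eqF.
  have zx : z < x by exact: lt_trans hx.
  have inz y : z <= y <= x -> 0 < y < e.
    move=> /andP[zy yx]; rewrite (lt_le_trans z0 zy)/=.
    exact: le_lt_trans xe.
  have zxx : z <= z <= x by rewrite lexx ltW.
  have [/andP[fl fu] z1 _ /andP[Fzl Fzu]] := small _ (inz _ zxx).
  have fz0 : 0 < f z by lra.
  have Fz0 : 0 < f z `^ m by exact: powR_gt0.
  have start : 0 < barrier_max n m p sigma ka al f d z + eps.
    have := @barrier_max_ge_rising _ n m p sigma ka al f d z m0 p0 z0.
    have : z * (barrier_slope m * al * (f z * f z `^ m)) < eps / 2.
      apply: (@le_lt_trans _ _ (h * K)).
        apply: ler_pM; [exact: ltW | | exact: ltW | ].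
          by apply/ltW/mulr_gt0; exact: mulr_gt0.
        rewrite /K; apply: ler_wpM2l; first by apply: mulr_ge0; exact: ltW.
        by apply: ler_pM => //; exact: ltW.
      by rewrite -ltr_pdivlMr// -mulrA -invfM.
    have : - (eps / 2) <= (sigma + n) * (f z `^ m * d z).
      pose w := (sigma + n) * (f z `^ m * (m * f z `^ m / f z)).
      have -> : (sigma + n) * (f z `^ m * d z) = w * fd z.
        by rewrite /w /fd; field; rewrite !gt_eqF.
      have w0 : 0 <= w by rewrite !mulr_ge0 ?invr_ge0 ?ltW//; lra.
      have wK : w <= K'.
        rewrite /w /K'; apply: ler_wpM2l; first lra.
        have mF : 0 <= m * f z `^ m by rewrite mulr_ge0// ltW.
        apply: ler_pM => //; first exact: ltW.
          by rewrite divr_ge0// ltW.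
        apply: ler_pM => //; first by rewrite invr_ge0 ltW.
          by rewrite ler_wpM2l// ltW.
        by rewrite lef_pV2 ?posrE//; lra.
      have -> : - (eps / 2) = K' * - (eps / (2 * K')).
        by field; rewrite gt_eqF.
      apply: (@le_trans _ _ (w * - (eps / (2 * K')))).
        by rewrite ler_wnM2r// oppr_le0 ltW.
      by rewrite ler_wpM2l// ltW.
    lra.
  have : 0 < barrier_max n m p sigma ka al f d x + eps * (1 + 2 * (C * x)).
    apply: (@barrier_max_gt0_forward _ n m p sigma ka al f d
      (fun y => eps * (1 + 2 * (C * y))) (cst (2 * C * eps)) z x) => //.
    - by move=> y /inz/andP[/flow].
    - move=> y _.
      have iD : is_derive y 1 (@idfun R) 1 by exact: is_derive_id.
      have oD : is_derive y 1 (cst (1 : R)) 0 by exact: is_derive_cst.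
      apply: (is_derive_eq (is_deriveZ eps (is_deriveD oD
        (is_deriveZ 2 (is_deriveZ C iD))))).
      have scE (r s : R) : r *: s = r * s by [].
      by rewrite !scE /=; ring.
    - move=> y /inz/andP[y0 _].
      have Cy : 0 <= C * y by rewrite mulr_ge0// ltW.
      by rewrite mulr_ge0 ?(ltW eps0)//; lra.
    - by move=> y _; rewrite /=; apply/ltW/mulr_gt0 => //; exact: mulr_gt0.
    - move=> y /inz ye _; have /andP[y0 _] := ye.
      have [/andP[fyl fyu] y1 Cy /andP[Fyl Fyu]] := small _ ye.
      have fy0 : 0 < f y by lra.
      have Fy0 : 0 < f y `^ m by exact: powR_gt0.
      have co : barrier_slope m * (ka * (al / m * (y * (f y / f y `^ m)))) <= C.
        rewrite /C; apply: ler_wpM2l; first exact: ltW.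
        apply: ler_wpM2l; first exact: ltW.
        apply: ler_wpM2l; first by rewrite divr_ge0 ?ltW.
        rewrite -[leRHS]mul1r; apply: ler_pM => //; first exact: ltW.
          by rewrite divr_ge0// ltW.
        apply: ler_pM; [exact: ltW | by rewrite invr_ge0 ltW | exact: ltW |].
        by rewrite lef_pV2 ?posrE.
      apply: (@le_trans _ _ (C * (eps * (1 + 2 * (C * y))))).
        apply: ler_wpM2r => //.
        have Cy0 : 0 <= C * y by rewrite mulr_ge0// ltW.
        by rewrite mulr_ge0 ?(ltW eps0)//; lra.
      rewrite /= [leRHS](_ : _ = C * (eps * 2)); last by ring.
      apply: ler_wpM2l; first exact: ltW.
      by apply: ler_wpM2l; [exact: ltW | lra].
    - have : 0 < eps * (2 * (C * z)).
        by apply: mulr_gt0 => //; apply: mulr_gt0 => //; exact: mulr_gt0.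
      by rewrite mulrDr mulr1; lra.
    - by rewrite lexx ltW.
  have xe0 : 0 < x < e by rewrite x0.
  have [_ _ Cx _] := small _ xe0.
  have : eps * (1 + 2 * (C * x)) <= eps * 2.
    by apply: ler_wpM2l; [exact: ltW | lra].
  rewrite /eps; lra.
exists (e / 2); first by rewrite divr_gt0.
apply: (barrier_max_ge0_gt0 adm (x0 := 0)); first by rewrite divr_gt0.
  by apply: flow; rewrite divr_gt0.
by move=> y /andP[y0 ye]; apply: ge0; rewrite y0 (le_lt_trans ye)//; lra.
Unshelve. all: by end_near. Qed.

(** * Contradiction with the tail *)

(** The upper tail bound forces [f] to decrease somewhere, after which [steepness] stays above a
    positive constant. The resulting growth of f^(-(p-m)/2) contradicts the lower tail bound. *)
Lemma no_tail (R : realType) (n m p sigma ka al C X0 : R)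
    (f d : R -> R) (x1 : R) :
  admissible n m p sigma ka al -> 0 <= x1 ->
  (forall x, x1 < x -> flow_at n m p sigma al (ka * al) f d x) ->
  (exists2 y, x1 < y & 0 < barrier_max n m p sigma ka al f d y) ->
  0 < C ->
  (forall x, X0 < x -> C / 2 * x `^ (- ((sigma + 2) / (p - m))) <= f x
                       <= 2 * C * x `^ (- ((sigma + 2) / (p - m)))) ->
  False.
Proof.
move=> adm x10 flow1 [x2 x12 bm2] C0 tail.
have [[m1 s0 k0 al0 pE] [n1 _ _]] := adm.
have m0 : 0 < m by lra.
have s20 : 0 < sigma + 2 by lra.
have pm0 : 0 < p - m by rewrite pE; have := mulr_gt0 k0 s20; lra.
set rho := (sigma + 2) / (p - m) in tail.
have rho0 : 0 < rho by exact: divr_gt0.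
have flow x : x2 <= x -> flow_at n m p sigma al (ka * al) f d x.
  by move=> x2x; apply: flow1; exact: lt_le_trans x2x.
have bm := barrier_max_gt0_stays adm flow bm2.
have [x20 f20 _ _] := flow _ (lexx x2).
have [x3 x23 d3] : exists2 x3, x2 < x3 & d x3 < 0.
  have e0 : 0 < f x2 / (2 * C) by rewrite divr_gt0// mulr_gt0.
  have [t t0 ht] := exists_small_powR rho0 e0.
  (* Beyond [x2], inside the range of the tail bounds, and with 1/y < t, so that 2 C y^(-rho) < f
     x2. *)
  pose y := Num.max (x2 + 1) (Num.max (X0 + 1) (2 / t)).
  have x2y : x2 < y by rewrite lt_max; apply/orP; left; lra.
  have X0y : X0 < y by rewrite !lt_max; apply/orP; right; apply/orP; left; lra.
  have ty : 2 / t <= y by rewrite !le_max lexx !orbT.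
  have y0 : 0 < y by exact: lt_trans x2y.
  have fy : f y < f x2.
    have /andP[_ fyu] := tail _ X0y.
    apply: (le_lt_trans fyu).
    rewrite mulrC -ltr_pdivlMr ?mulr_gt0// powRN -powR_inv1 ?powR_ge0//.
    rewrite -powRrM mulrC powRrM powR_inv1; last exact: ltW.
    apply: ht; rewrite invr_ge0 ltW//=.
    rewrite -[t]invrK ltf_pV2 ?posrE ?invr_gt0//.
    by apply: lt_le_trans ty; rewrite ltr_pdivlMr// mulVf ?gt_eqF//; lra.
  have flow' z : x2 <= z <= y -> flow_at n m p sigma al (ka * al) f d z.
    by move=> /andP[/flow].
  have [c /andP[x2c _]] := slope_sign_between m0 x2y flow' (negbT (gt_eqF fy)).
  rewrite nmulr_lgt0 ?subr_lt0// => dc.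
  by exists c.
have flow3 x : x3 <= x -> flow_at n m p sigma al (ka * al) f d x.
  by move=> x3x; apply: flow; exact: le_trans (ltW x23) x3x.
have bm3 x : x3 <= x -> 0 < barrier_max n m p sigma ka al f d x.
  by move=> x3x; apply: bm; exact: le_trans (ltW x23) x3x.
have dneg := slope_stays_negative adm flow3 bm3 d3.
have steep x : x3 <= x -> 0 < barrier n m p sigma al (ka * al) 1 1 f d x.
  move=> x3x; apply: (barrier_steep_gt0 adm (flow3 _ x3x) _ (bm3 _ x3x)).
  exact: ltW (dneg _ x3x).
have [x30 f30 _ _] := flow3 _ (lexx x3).
pose c := steepness m p sigma f d x3.
have c0 : 0 < c by rewrite mulr_gt0 ?oppr_gt0// mulr_gt0// powR_gt0.
have hc y : x3 <= y -> c <= steepness m p sigma f d y.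
  by move=> x3y; exact: (steepness_nondecreasing m0 pE flow3 steep).
have mp : m < p by lra.
have growth := steep_growth m0 s0 mp flow3 hc.
pose q := (p - m) / 2.
have q0 : 0 < q by rewrite divr_gt0.
pose x4 := Num.max x3 (X0 + 1).
apply: (@no_steep_tail R (sigma + 2) ((p - m) / (2 * m) * c / (sigma + 2))
  (x3 `^ (sigma + 2)) ((C / 2) `^ (- q)) x4) => //.
- by rewrite divr_gt0// mulr_gt0// divr_gt0// mulr_gt0.
- exact: powR_ge0.
move=> x; rewrite ge_max => /andP[x3x X0x].
apply: (le_trans (growth _ x3x)).
have [xp fx0 _ _] := flow3 _ x3x.
have X0x' : X0 < x by lra.
have /andP[fl _] := tail x X0x'.
(* Because rho q = (sigma + 2)/2, raising the lower tail bound to the negative power -q bounds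
   f^(-q) above by a multiple of x^((sigma+2)/2). *)
have -> : x `^ ((sigma + 2) / 2) = (x `^ (- rho)) `^ (- q).
  by rewrite -powRrM; congr (_ `^ _); rewrite /rho /q; field; rewrite gt_eqF.
rewrite -powRM ?powR_ge0//; last by rewrite divr_ge0// ltW.
rewrite -/q !(powRN _ q) lef_pV2 ?posrE ?powR_gt0 ?mulr_gt0 ?powR_gt0 ?invr_gt0//.
apply: ge0_ler_powR => //; rewrite ?nnegrE; [exact: ltW | | exact: ltW].
by rewrite mulr_ge0 ?powR_ge0// divr_ge0// ltW.
Qed.

(** The zero set is bounded by the tail and closed by continuity, so it contains its supremum.
    Beyond that point the equation holds without interruption. *)
Lemma last_zero (R : realType) (f : R -> R) (X0 : R) :
  {within `[0, +oo[, continuous f} -> (forall x, 0 <= x -> 0 <= f x) ->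
  (forall x, X0 < x -> 0 < f x) ->
  (forall x, 0 <= x -> 0 < f x) \/
  exists x0, [/\ 0 <= x0, f x0 = 0 & forall x, x0 < x -> 0 < f x].
Proof.
move=> /continuous_within_itvcyP[fc _] f0 fX0.
pose E := [set x | 0 <= x /\ f x = 0].
have [[e Ee]|E0] := pselect (exists e, E e); last first.
  left=> x x0; rewrite lt_neqAle f0// andbT eq_sym; apply/eqP => fx0.
  by apply: E0; exists x.
right; have supE : has_sup E.
  split; first by exists e.
  exists X0 => x [x0 fx]; rewrite leNgt; apply/negP => /fX0.
  by rewrite fx ltxx.
have eE x : E x -> x <= sup E by move=> Ex; apply: ub_le_sup => //; exact: supE.2.
have E0 : 0 <= sup E by apply: le_trans (eE _ Ee); exact: Ee.1.
exists (sup E); split=> //; last first.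
  move=> x Ex; rewrite lt_neqAle f0 ?(le_trans E0 (ltW Ex))// andbT eq_sym.
  apply/eqP => fx0; have : x <= sup E by apply: eE; split=> //; lra.
  by rewrite leNgt Ex.
(* Continuity at 0 is one-sided, so this case is settled directly: the known zero [e] must be 0. *)
have [sE0|En0] := eqVneq (sup E) 0.
  have -> : sup E = e.
    by apply/eqP; rewrite eq_le eE// andbT sE0; exact: Ee.1.
  exact: Ee.2.
have Ep : 0 < sup E by rewrite lt_neqAle eq_sym En0 E0.
apply: contrapT => /eqP fn0.
have fp : 0 < f (sup E) by rewrite lt_neqAle eq_sym fn0 f0.
have fcE : {for sup E, continuous f} by apply: fc; rewrite in_itv/= Ep.
have /nbhs_ballP[r /= r0 Hr] : \forall y \near sup E, 0 < f y.
  exact: (cvgr_gt (f (sup E)) fcE).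
have [y Ey yr] := sup_adherent r0 supE.
have : 0 < f y.
  apply: Hr; rewrite /ball/= ltr_distlC.
  by have := eE _ Ey => yE; apply/andP; split; lra.
by rewrite Ey.2 ltxx.
Qed.

(** The bound on sigma enters through N (m-1) < m N + 2 <= sigma (m-1) < sigma (m+1). *)
Lemma admissible_params (R : realType) (N : nat) (m p sigma : R) :
  1 < m -> 0 < sigma -> (1 <= N)%N -> m < p ->
  (p%:E < sobolev_exp N m sigma)%E -> sigma_star N m <= sigma ->
  admissible N%:R m p sigma ((p - m) / (sigma + 2)) (ss_alpha m p sigma).
Proof.
move=> m1 s0 N1 mp ps sstar.
have s20 : 0 < sigma + 2 by lra.
have n1 : 1 <= N%:R :> R by rewrite ler1n.
have L0 : 0 < ss_L m p sigma.
  by rewrite /ss_L addr_gt0// mulr_gt0//; lra.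
split; split=> //.
- by rewrite divr_gt0 ?subr_gt0.
- by rewrite divr_gt0.
- by rewrite divfK ?gt_eqF//; lra.
- move: sstar; rewrite /sigma_star ler_pdivrMr ?subr_gt0// => sstar.
  have : N%:R * (m - 1) < m * N%:R + 2 by lra.
  move/lt_le_trans => /(_ _ sstar)/lt_trans; apply.
  by rewrite ltr_pM2l//; lra.
- move: ps; rewrite /sobolev_exp; case: ifPn => [N3|].
    have n3 : 3 <= N%:R :> R by rewrite (ler_nat _ 3).
    rewrite lte_fin ltr_pdivlMr; last lra.
    move=> ps; have -> : (N%:R - 2) * (p + m) = p * (N%:R - 2) + m * (N%:R - 2) by ring.
    lra.
  (* For N <= 2 the exponent is infinite, but the left-hand side is nonpositive. *)
  rewrite -ltnNge ltnS => N2 _.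
  have n2 : N%:R <= 2 :> R by rewrite (ler_nat _ _ 2).
  apply: (@le_trans _ _ 0); last by rewrite !mulr_ge0//; lra.
  by rewrite mulr_le0_ge0//; lra.
Qed.

Lemma tail_bounds (R : realType) (m p sigma : R) (f : R -> R) :
  tail_decay m p sigma f ->
  exists C X0 : R, 0 < C /\ forall x, X0 < x ->
    C / 2 * x `^ (- ((sigma + 2) / (p - m))) <= f x
      <= 2 * C * x `^ (- ((sigma + 2) / (p - m))).
Proof.
move=> [C [C0 Cf]]; exists C.
set g := (fun xi : R => C * _) in Cf.
have g0 : \forall x \near +oo, 0 < g x.
  near=> x; rewrite mulr_gt0// powR_gt0//; near: x; exact: nbhs_pinfty_gt.
have g1 : \forall x \near +oo, 2^-1 < f x / g x.
  by apply: (cvgr_gt 1 Cf); lra.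
have g2 : \forall x \near +oo, f x / g x < 2 by apply: (cvgr_lt 1 Cf); lra.
have [X0 [_ HX]] : \forall x \near +oo, 2^-1 * g x <= f x <= 2 * g x.
  near=> x.
  have gx0 : 0 < g x by near: x.
  have h1 : 2^-1 < f x / g x by near: x.
  have h2 : f x / g x < 2 by near: x.
  by move: h1 h2; rewrite ltr_pdivlMr// ltr_pdivrMr// => /ltW -> /ltW ->.
exists X0; split=> // x /HX; rewrite /g.
by rewrite !mulrA (mulrC 2^-1).
Unshelve. all: by end_near. Qed.

Theorem theorem1p2 (R : realType) (N : nat) (m p sigma : R)
    (hm : 1 < m) (hsigma : 0 < sigma) (hN : (1 <= N)%N)
    (hmp : m < p) (hps : (p%:E < sobolev_exp N m sigma)%E)
    (hstar : sigma_star N m <= sigma) :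
  ~ exists (T : R) (u : 'rV[R]_N -> R -> R),
      0 < T /\ self_similar_solution m p sigma T u.
Proof.
move=> [T [u [_ [_ _ [f [[[fc f0] fode _ forigin ftail] _]]]]]].
have m0 : 0 < m by lra.
have s20 : 0 < sigma + 2 by lra.
have adm := admissible_params hm hsigma hN hmp hps hstar.
set ka := (p - m) / (sigma + 2) in adm.
set al := ss_alpha m p sigma in adm.
have beE : ss_beta m p sigma = ka * al.
  by rewrite /ss_beta /ka /al /ss_alpha mulrA divfK// gt_eqF.
pose d := derive1 (fpow m f).
have flow x : 0 < x -> 0 < f x -> flow_at N%:R m p sigma al (ka * al) f d x.
  by move=> x0 fx0; rewrite -beE; exact: profile_flow_at (fode _ x0 fx0).
have [C [X0 [C0 tail]]] := tail_bounds ftail.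
have fX x : Num.max X0 0 < x -> 0 < f x.
  rewrite gt_max => /andP[/tail/andP[+ _] x0]; apply: lt_le_trans.
  by rewrite mulr_gt0 ?powR_gt0// divr_gt0.
(* The last positivity component starts either at an origin with f(0) > 0 or at a zero of [f], be it
   the origin or an interface. *)
have [fpos|[x0 [x00 fx0 fpos]]] := last_zero fc f0 fX.
  have flow0 x : 0 < x -> flow_at N%:R m p sigma al (ka * al) f d x.
    by move=> xp; apply: flow => //; exact/fpos/ltW.
  have fp0 : 0 < f 0 by exact: fpos.
  (* The other two behaviours at the origin have f(0) = 0. *)
  have f'0 : (f h - f 0) / h @[h --> 0^'+] --> (0 : R).
    case: forigin => [[]//|[f00 _]|[xi0 [delta [xi00 _ /(_ 0) fz _ _]]]].
      by rewrite f00 ltxx in fp0.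
    by rewrite fz ?lexx ?ltW// ltxx in fp0.
  exact: (no_tail adm (lexx 0) flow0
    (barrier_starts_positive adm flow0 fc fp0 f'0) C0 tail).
have flow0 x : x0 < x -> flow_at N%:R m p sigma al (ka * al) f d x.
  by move=> x0x; apply: flow; [exact: le_lt_trans x0x | exact: fpos].
have fx00 : f y @[y --> x0^'+] --> 0.
  have [fcx fc0] := (continuous_within_itvcyP 0 f).1 fc.
  rewrite -fx0; have [x0E|x0n] := eqVneq x0 0; first by rewrite x0E.
  apply: cvg_at_right_filter; apply: fcx.
  by rewrite in_itv/= andbT lt_neqAle eq_sym x0n x00.
exact: (no_tail adm x00 flow0 (barrier_starts_at_zero adm x00 flow0 fx00) C0 tail).
Qed.
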